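(* Let $g:[0,\infty)\to\mathbb{R}$ be a function such that $\lim_{t\to\infty}g(t)=0$. Then there exist a convex $C^1$-function $f:\mathbb{R}\to\mathbb{R}$ and a gradient flow $x:[0,\infty)\to\mathbb{R}$, $t\mapsto x_t$, of $f$ such that $\inf_{x\in\mathbb{R}}f(x)=0$ and $f(x_t)\ge g(t)$ for all $t\ge 1$.
   Context: A gradient flow of a $C^1$-function $f:\mathbb{R}\to\mathbb{R}$ is a differentiable curve $x:[0,\infty)\to\mathbb{R}$ satisfying $\dot x_t=-f'(x_t)$ for all $t\ge 0$.
   Formalization: The function g is additionally assumed bounded above on [1,∞); without this the claim fails, e.g. for g(t)=1/(2−t) when t<2 and g(t)=0 when t≥2, since f(x_t) is continuous and so bounded on [1,2]. *)

(* Defs.v *)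
From Stdlib Require Export Reals.
From Coquelicot Require Export Coquelicot.
Open Scope R_scope.

Definition is_convex (f : R -> R) : Prop :=
  forall x y s : R, 0 <= s <= 1 ->
    f (s * x + (1 - s) * y) <= s * f x + (1 - s) * f y.

Definition is_C1 (f : R -> R) : Prop :=
  (forall x : R, ex_derive f x) /\ (forall x : R, continuous (Derive f) x).

(* [D_in] takes the limit of the difference quotient inside [0, oo), so the
   derivative at [t = 0] is one-sided and the values of [x] at negative times
   are irrelevant. *)
Definition is_gradient_flow (f x : R -> R) : Prop :=
  forall t : R, 0 <= t ->
    D_in x (fun s => - Derive f (x s)) (fun s => 0 <= s) t.

(* Main.v *)
(** We look for a smooth convex [h] on the line that decreases to [0], dominates
    [g] on [1, oo), and is to be the energy [f (x t)] along the flow.  Then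
    [h' = - v^2], where [v] is the speed of the flow, so [x] has to be the primitive
    of [v = sqrt (- h')] and [f] has to be [h] composed with the inverse of [x].
    As [v] is nonincreasing, [- v (t)] is a subgradient of [f] at [x (t)], and a
    continuous selection of subgradients is a derivative.

    For [h] we superpose rescaled copies of [sqrt (1 + u^2) - u] with geometric
    weights, the [n]-th copy being stretched until [g] has dropped below
    [M / 2^(n+1)].  The tail of this function is so heavy that [v] is at least of
    order [1 / t]; hence [x] is onto the line and [f] is defined everywhere. *)

Require Import Defs.
From Stdlib Require Import Reals Lra Lia IndefiniteDescription.
From Coquelicot Require Import Coquelicot.
Open Scope R_scope.

(** * Subgradients *)

Lemma subgradient_convex (f q : R -> R) :
  (forall y z, f y + q y * (z - y) <= f z) -> is_convex f.
Proof.
intros sub x y s Hs.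
pose proof (sub (s * x + (1 - s) * y) x) as Hx.
pose proof (sub (s * x + (1 - s) * y) y) as Hy.
set (w := s * x + (1 - s) * y) in *.
apply (Rmult_le_compat_l s) in Hx; [|lra].
apply (Rmult_le_compat_l (1 - s)) in Hy; [|lra].
apply Rle_trans with (2 := Rplus_le_compat _ _ _ _ Hx Hy).
apply Req_le; unfold w; ring.
Qed.

(** The subgradient inequalities at [y] and at [y + k] squeeze [f (y + k) - f y - q y * k] between
    [0] and [(q (y + k) - q y) * k], so continuity of [q] controls the difference quotient. *)
Lemma subgradient_is_derive (f q : R -> R) (y : R) :
  (forall y z, f y + q y * (z - y) <= f z) -> continuous q y ->
  is_derive f y (q y).
Proof.
intros sub cq; apply is_derive_Reals; intros eps Heps.
apply continuity_pt_filterlim in cq.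
destruct (cq eps Heps) as [d [Hd Hq]].
exists (mkposreal d Hd); intros k Hk Hkd; simpl in Hkd.
assert (Hclose : Rabs (q (y + k) - q y) < eps).
{ apply Hq; split; [split; [exact I | lra]|].
  simpl; unfold Rdist; replace (y + k - y) with k by ring; exact Hkd. }
pose proof (sub y (y + k)) as H1; pose proof (sub (y + k) y) as H2.
replace (y + k - y) with k in H1 by ring.
replace (y - (y + k)) with (- k) in H2 by ring.
replace ((f (y + k) - f y) / k - q y)
  with ((f (y + k) - f y - q y * k) / k) by (field; exact Hk).
unfold Rdiv; rewrite Rabs_mult, Rabs_inv.
apply Rle_lt_trans with (2 := Hclose).
assert (Hk0 : 0 < Rabs k) by (apply Rabs_pos_lt; exact Hk).
apply (Rmult_le_reg_r (Rabs k)); [exact Hk0|].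
rewrite Rmult_assoc, Rinv_l, Rmult_1_r, <- Rabs_mult by lra.
rewrite Rabs_pos_eq by lra.
apply Rle_trans with (2 := Rle_abs _); lra.
Qed.

(** Adding the bounds for [(s, t)] and [(t, s)] cancels [h] and leaves [0 <= (dh s - dh t) * (s - t)
    <= 2 * K * (s - t) ^ 2], so [dh] is Lipschitz. *)
Lemma smooth_convex_continuous (h dh : R -> R) (K t : R) :
  (forall s t, 0 <= h s - h t - dh t * (s - t) <= K * (s - t) ^ 2) ->
  continuous dh t.
Proof.
intros quad; apply continuity_pt_filterlim; intros eps Heps.
assert (HK : 0 <= K) by (pose proof (quad 1 0) as H; lra).
(* The [+ 1] keeps the divisor positive when [K = 0]. *)
exists (eps / (2 * K + 1)); split; [apply Rdiv_lt_0_compat; lra|].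
intros s [[_ Hst] Hd]; simpl in Hd |- *; unfold Rdist in *.
pose proof (quad s t) as H1; pose proof (quad t s) as H2.
assert (H3 : 0 < Rabs (s - t)) by (apply Rabs_pos_lt; lra).
assert (Hlip : Rabs (dh s - dh t) <= 2 * K * Rabs (s - t)).
{ apply (Rmult_le_reg_r (Rabs (s - t))); [exact H3|].
  rewrite <- Rabs_mult, Rmult_assoc, <- Rabs_mult.
  replace ((s - t) * (s - t)) with ((s - t) ^ 2) by ring.
  rewrite (Rabs_pos_eq ((s - t) ^ 2)) by apply pow2_ge_0.
  rewrite Rabs_pos_eq; nra. }
apply Rle_lt_trans with (1 := Hlip).
apply Rle_lt_trans with ((2 * K + 1) * Rabs (s - t)); [nra|].
apply (Rmult_lt_compat_l (2 * K + 1)) in Hd; [|lra].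
replace eps with ((2 * K + 1) * (eps / (2 * K + 1))) by (field; lra).
exact Hd.
Qed.

(** * The profile *)

(** A branch of a hyperbola, equal to [1 / (sqrt (1 + u ^ 2) + u)]: asymptotic to [1 / (2 * u)] at
    [+oo] and to [- 2 * u] at [-oo]. *)
Definition profile (u : R) : R := sqrt (1 + u ^ 2) - u.
Definition profile' (u : R) : R := u / sqrt (1 + u ^ 2) - 1.

Lemma sqrt_1_plus_sqr (u : R) :
  1 <= sqrt (1 + u ^ 2) /\ sqrt (1 + u ^ 2) * sqrt (1 + u ^ 2) = 1 + u ^ 2.
Proof.
pose proof (pow2_ge_0 u); split; [|apply sqrt_sqrt; lra].
rewrite <- sqrt_1 at 1; apply sqrt_le_1; lra.
Qed.

Lemma profile_pos (u : R) : 0 < profile u.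
Proof.
unfold profile; destruct (sqrt_1_plus_sqr u) as [H1 H2].
destruct (Rle_dec u 0); nra.
Qed.

Lemma profile_le (u : R) : profile u <= 1 + 2 * Rabs u.
Proof.
unfold profile; destruct (sqrt_1_plus_sqr u) as [H1 H2].
assert (sqrt (1 + u ^ 2) <= 1 + Rabs u).
{ pose proof (Rabs_pos u); pose proof (pow2_abs u); nra. }
pose proof (Rle_abs (- u)) as Hu; rewrite Rabs_Ropp in Hu; lra.
Qed.

Lemma profile_le_1 (u : R) : 0 <= u -> profile u <= 1.
Proof. unfold profile; destruct (sqrt_1_plus_sqr u); nra. Qed.

Lemma profile_le_inv (u : R) : 0 <= u -> u * profile u <= 1.
Proof. unfold profile; destruct (sqrt_1_plus_sqr u); nra. Qed.

(** The profile decreases and [profile 1 = sqrt 2 - 1 > / 3]. *)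
Lemma profile_ge (u : R) : u <= 1 -> / 3 <= profile u.
Proof. unfold profile; destruct (sqrt_1_plus_sqr u); nra. Qed.

(** With [B = sqrt (1 + u ^ 2)], clearing denominators turns the claim into
    [B ^ 2 - u ^ 2 <= 2 * B ^ 2 - 2 * u * B], that is [0 <= (B - u) ^ 2]. *)
Lemma profile'_le (u : R) : profile' u <= - / (2 * (1 + u ^ 2)).
Proof.
unfold profile'; destruct (sqrt_1_plus_sqr u) as [H1 H2].
set (B := sqrt (1 + u ^ 2)) in *; rewrite <- H2.
apply (Rmult_le_reg_r (2 * (B * B))); [nra|].
replace ((u / B - 1) * (2 * (B * B))) with (2 * u * B - 2 * (B * B)) by (field; lra).
replace (- / (2 * (B * B)) * (2 * (B * B))) with (-1) by (field; lra).
pose proof (pow2_ge_0 (B - u)); nra.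
Qed.

Lemma Rabs_profile'_le (u : R) : Rabs (profile' u) <= 2.
Proof.
unfold profile'; destruct (sqrt_1_plus_sqr u) as [H1 H2].
set (B := sqrt (1 + u ^ 2)) in *.
apply (Rmult_le_reg_r B); [lra|].
rewrite <- (Rabs_pos_eq B) at 2 by lra; rewrite <- Rabs_mult.
replace ((u / B - 1) * B) with (u - B) by (field; lra).
apply Rabs_le; nra.
Qed.

(** The remainder is [(A * B - 1 - t * s) / B]: it is nonnegative by Cauchy-Schwarz for [(1, s)] and
    [(1, t)], and [2 * A * B <= A ^ 2 + B ^ 2] with [B >= 1] bounds it above. Unlike
    differentiability, such an inequality can be summed term by term. *)
Lemma profile_quadratic (s t : R) :
  0 <= profile s - profile t - profile' t * (s - t) <= (s - t) ^ 2.
Proof.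
unfold profile, profile'.
destruct (sqrt_1_plus_sqr s) as [A1 A2]; destruct (sqrt_1_plus_sqr t) as [B1 B2].
set (A := sqrt (1 + s ^ 2)) in *; set (B := sqrt (1 + t ^ 2)) in *.
replace (A - s - (B - t) - (t / B - 1) * (s - t))
  with ((A * B - 1 - t * s) / B).
2: { apply (Rmult_eq_reg_r B); [|lra]; field_simplify; [|lra|lra]; nra. }
assert (Hlow : 0 <= A * B - 1 - t * s).
{ assert (Hsq : (1 + t * s) * (1 + t * s) <= (A * B) * (A * B)).
  { replace ((A * B) * (A * B)) with ((A * A) * (B * B)) by ring.
    rewrite A2, B2; pose proof (pow2_ge_0 (s - t)); nra. }
  assert (0 < A * B) by nra.
  destruct (Rle_dec (1 + t * s) (A * B)); nra. }
assert (Hup : A * B - 1 - t * s <= (s - t) ^ 2).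
{ pose proof (pow2_ge_0 (A - B)); nra. }
split.
- apply Rmult_le_pos; [lra | left; apply Rinv_0_lt_compat; lra].
- apply (Rmult_le_reg_r B); [lra|].
  unfold Rdiv; rewrite Rmult_assoc, Rinv_l, Rmult_1_r by lra.
  pose proof (pow2_ge_0 (s - t)); nra.
Qed.

(** * Nonnegative series *)

Lemma Series_nonneg (a : nat -> R) :
  (forall n, 0 <= a n) -> ex_series a -> 0 <= Series a.
Proof.
intros Ha ex.
replace 0 with (Series (fun n => 0 * a n)).
- apply Series_le; [intros n; pose proof (Ha n); lra | exact ex].
- rewrite Series_scal_l; ring.
Qed.

Lemma Series_ge_term (a : nat -> R) (n : nat) :
  (forall n, 0 <= a n) -> ex_series a -> a n <= Series a.
Proof.
intros Ha ex; rewrite (Series_incr_n a (S n)); [|lia|exact ex]; simpl pred.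
assert (Htail : 0 <= Series (fun k => a (S n + k)%nat)).
{ apply Series_nonneg; [intros k; apply Ha | apply (ex_series_incr_n a); exact ex]. }
assert (Hsum : a n <= sum_f_R0 a n).
{ destruct n as [|n]; simpl; [lra|].
  pose proof (cond_pos_sum a n Ha); lra. }
lra.
Qed.

Lemma ex_series_half_pow_scal (C : R) : ex_series (fun n => C * (/ 2) ^ n).
Proof.
apply (ex_series_scal_l (K := R_AbsRing) C (fun n => (/ 2) ^ n)).
exists (/ (1 - / 2)); apply is_series_geom; rewrite Rabs_pos_eq; lra.
Qed.

Lemma Series_half_pow_scal (C : R) : Series (fun n => C * (/ 2) ^ n) = 2 * C.
Proof.
assert (Hq : Rabs (/ 2) < 1) by (rewrite Rabs_pos_eq; lra).
rewrite Series_scal_l.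
rewrite (is_series_unique (pow (/ 2)) _ (is_series_geom _ Hq)); field.
Qed.

(** * Superposition of rescaled profiles *)

Section Superposition.

Variables (C : R) (b : nat -> R).
Hypothesis C_pos : 0 < C.
Hypothesis b_bounds : forall n, 0 < b n <= 1.

(** [/ b n] is the time scale of the [n]-th copy; [b n <= 1] makes the bounds on the copies uniform
    in [n]. *)
Let term (t : R) (n : nat) : R := C * (/ 2) ^ n * profile (b n * t).
Let term' (t : R) (n : nat) : R := C * (/ 2) ^ n * (b n * profile' (b n * t)).

Definition superposition (t : R) : R := Series (term t).
Definition superposition' (t : R) : R := Series (term' t).

Let weight_pos (n : nat) : 0 < C * (/ 2) ^ n.
Proof. apply Rmult_lt_0_compat; [exact C_pos | apply pow_lt; lra]. Qed.

Let term_pos (t : R) (n : nat) : 0 < term t n.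
Proof. apply Rmult_lt_0_compat; [apply weight_pos | apply profile_pos]. Qed.

Let ex_term (t : R) : ex_series (term t).
Proof.
apply (ex_series_le (K := R_AbsRing) (V := R_CompleteNormedModule) _
  (fun n => C * (1 + 2 * Rabs t) * (/ 2) ^ n)); [|apply ex_series_half_pow_scal].
intros n; change (Rabs (term t n) <= C * (1 + 2 * Rabs t) * (/ 2) ^ n).
rewrite Rabs_pos_eq by (left; apply term_pos).
unfold term; pose proof (profile_le (b n * t)) as H.
rewrite Rabs_mult, (Rabs_pos_eq (b n)) in H by (pose proof (b_bounds n); lra).
pose proof (weight_pos n); pose proof (b_bounds n); pose proof (Rabs_pos t).
replace (C * (1 + 2 * Rabs t) * (/ 2) ^ n)
  with (C * (/ 2) ^ n * (1 + 2 * Rabs t)) by ring.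
apply Rmult_le_compat_l; nra.
Qed.

Let ex_term' (t : R) : ex_series (term' t).
Proof.
apply (ex_series_le (K := R_AbsRing) (V := R_CompleteNormedModule) _
  (fun n => C * 2 * (/ 2) ^ n)); [|apply ex_series_half_pow_scal].
intros n; change (Rabs (term' t n) <= C * 2 * (/ 2) ^ n).
unfold term'; pose proof (weight_pos n); pose proof (b_bounds n).
rewrite (Rabs_mult (C * _)), (Rabs_mult (b n)).
rewrite (Rabs_pos_eq (C * (/ 2) ^ n)), (Rabs_pos_eq (b n)) by lra.
replace (C * 2 * (/ 2) ^ n) with (C * (/ 2) ^ n * 2) by ring.
pose proof (Rabs_profile'_le (b n * t)); pose proof (Rabs_pos (profile' (b n * t))).
apply Rmult_le_compat_l; nra.
Qed.

Lemma superposition_ge_term (n : nat) (t : R) :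
  C * (/ 2) ^ n * profile (b n * t) <= superposition t.
Proof.
apply (Series_ge_term (term t) n); [intros k; left; apply term_pos | apply ex_term].
Qed.

Lemma superposition_pos (t : R) : 0 < superposition t.
Proof.
apply Rlt_le_trans with (2 := superposition_ge_term 0 t); apply (term_pos t 0).
Qed.

(** Rescaling multiplies the quadratic bound of a copy by [b n ^ 2 <= 1], and the weights sum to
    [2 * C]. *)
Lemma superposition_quadratic (s t : R) :
  0 <= superposition s - superposition t - superposition' t * (s - t)
    <= 2 * C * (s - t) ^ 2.
Proof.
set (r n := term s n - term t n - (s - t) * term' t n).
assert (ex_st : ex_series (fun n => term s n - term t n)).
{ apply (ex_series_minus (V := R_NormedModule) (term s) (term t)); apply ex_term. }
assert (ex' : ex_series (fun n => (s - t) * term' t n)).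
{ apply (ex_series_scal_l (K := R_AbsRing) (s - t) (term' t)); apply ex_term'. }
replace (superposition s - superposition t - superposition' t * (s - t))
  with (Series r).
2: { unfold r, superposition, superposition'.
  rewrite Series_minus, Series_minus, Series_scal_l; auto; ring. }
assert (Hr : forall n, 0 <= r n <= C * (s - t) ^ 2 * (/ 2) ^ n).
{ intros n; pose proof (weight_pos n); pose proof (b_bounds n).
  pose proof (profile_quadratic (b n * s) (b n * t)) as [H1 H2].
  replace (r n) with (C * (/ 2) ^ n * (profile (b n * s) - profile (b n * t)
    - profile' (b n * t) * (b n * s - b n * t))) by (unfold r, term, term'; ring).
  split; [apply Rmult_le_pos; lra|].
  replace (C * (s - t) ^ 2 * (/ 2) ^ n) with (C * (/ 2) ^ n * (s - t) ^ 2) by ring.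
  apply Rmult_le_compat_l; [lra|].
  apply Rle_trans with (1 := H2).
  replace ((b n * s - b n * t) ^ 2) with (b n * b n * (s - t) ^ 2) by ring.
  pose proof (pow2_ge_0 (s - t)); assert (b n * b n <= 1) by nra; nra. }
pose proof (ex_series_half_pow_scal (C * (s - t) ^ 2)) as exg.
split.
- apply Series_nonneg; [intros n; apply Hr|].
  apply (ex_series_minus (V := R_NormedModule) _ _ ex_st ex').
- replace (2 * C * (s - t) ^ 2) with (2 * (C * (s - t) ^ 2)) by ring.
  rewrite <- Series_half_pow_scal; apply Series_le; assumption.
Qed.

(** All terms of the series are negative, so the one of index [0] bounds the sum from above. *)
Lemma superposition'_le (t : R) :
  superposition' t <= - (C * b 0%nat / 2) / (1 + t ^ 2).
Proof.
assert (Hneg : forall u, profile' u < 0).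
{ intros u; apply Rle_lt_trans with (1 := profile'_le u).
  apply Ropp_lt_gt_0_contravar, Rinv_0_lt_compat; pose proof (pow2_ge_0 u); lra. }
assert (H0 : - term' t 0 <= - superposition' t).
{ replace (- superposition' t) with (Series (fun n => -1 * term' t n))
    by (rewrite Series_scal_l; unfold superposition'; ring).
  replace (- term' t 0) with (-1 * term' t 0) by ring.
  apply (Series_ge_term (fun n => -1 * term' t n) 0).
  - intros n; unfold term'; pose proof (weight_pos n); pose proof (b_bounds n).
    pose proof (Hneg (b n * t)); assert (b n * profile' (b n * t) <= 0) by nra; nra.
  - apply (ex_series_scal_l (K := R_AbsRing) (-1) (term' t)); apply ex_term'. }
apply Rle_trans with (term' t 0); [lra|].
unfold term'; rewrite pow_O, Rmult_1_r.
pose proof (b_bounds 0) as [Hb0 Hb1].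
assert (Hle : / (2 * (1 + t ^ 2)) <= / (2 * (1 + (b 0%nat * t) ^ 2))).
{ pose proof (pow2_ge_0 t); pose proof (pow2_ge_0 (b 0%nat * t)).
  apply Rinv_le_contravar; [lra|].
  replace ((b 0%nat * t) ^ 2) with (b 0%nat * b 0%nat * t ^ 2) by ring.
  assert (b 0%nat * b 0%nat <= 1) by nra; nra. }
pose proof (profile'_le (b 0%nat * t)).
replace (- (C * b 0%nat / 2) / (1 + t ^ 2))
  with (C * (b 0%nat * (- / (2 * (1 + t ^ 2)))))
  by (field; pose proof (pow2_ge_0 t); lra).
apply Rmult_le_compat_l; [lra|]; apply Rmult_le_compat_l; lra.
Qed.

Lemma superposition_small (eps : R) : 0 < eps -> exists t, superposition t < eps.
Proof.
intros Heps.
destruct (pow_lt_1_zero (/ 2) ltac:(rewrite Rabs_pos_eq; lra) (eps / (2 * C))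
  ltac:(apply Rdiv_lt_0_compat; lra)) as [N HN].
specialize (HN N (le_n N)).
rewrite Rabs_pos_eq in HN by (left; apply pow_lt; lra).
assert (HN' : C * (/ 2) ^ N < eps / 2).
{ apply (Rmult_lt_compat_l C) in HN; [|lra].
  replace (C * (eps / (2 * C))) with (eps / 2) in HN by (field; lra); exact HN. }
(* By [profile_le_inv], the terms up to [N] add up to at most [S0 / t]; [t] is then chosen so that
   [eps / 2 * t = S0 + eps / 2]. *)
set (S0 := sum_f_R0 (fun n => C * (/ 2) ^ n * / b n) N).
assert (HS0 : 0 <= S0).
{ apply cond_pos_sum; intros n; apply Rmult_le_pos; [left; apply weight_pos|].
  left; apply Rinv_0_lt_compat, b_bounds. }
set (t := 2 * S0 / eps + 1); exists t.
assert (Ht : 0 < t /\ S0 / t < eps / 2).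
{ assert (0 <= 2 * S0 / eps)
    by (apply Rmult_le_pos; [lra | left; apply Rinv_0_lt_compat; lra]).
  assert (Hpos : 0 < t) by (unfold t; lra); split; [exact Hpos|].
  apply (Rmult_lt_reg_r t); [exact Hpos|].
  replace (S0 / t * t) with S0 by (field; lra).
  replace (eps / 2 * t) with (S0 + eps / 2) by (unfold t; field; lra); lra. }
destruct Ht as [Ht HSt].
unfold superposition; rewrite (Series_incr_n (term t) (S N)); [|lia|apply ex_term].
simpl pred.
assert (Hhead : sum_f_R0 (term t) N <= S0 / t).
{ unfold S0, Rdiv; rewrite Rmult_comm, scal_sum.
  apply sum_Rle; intros n _; unfold term; rewrite (Rmult_assoc (C * _)).
  apply Rmult_le_compat_l; [left; apply weight_pos|].
  pose proof (b_bounds n) as [Hb _].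
  apply (Rmult_le_reg_l (b n * t)); [apply Rmult_lt_0_compat; assumption|].
  replace (b n * t * (/ b n * / t)) with 1 by (field; lra).
  apply profile_le_inv; nra. }
assert (Htail : Series (fun k => term t (S N + k)%nat) <= C * (/ 2) ^ N).
(* The tail starts at index [S N], and its weights sum to twice the first of them. *)
{ replace (C * (/ 2) ^ N) with (2 * (C * (/ 2) ^ S N)) by (simpl; field).
  rewrite <- Series_half_pow_scal.
  apply Series_le; [|apply ex_series_half_pow_scal].
  intros k; split; [left; apply term_pos|].
  unfold term; rewrite (pow_add _ (S N) k), <- (Rmult_assoc C).
  pose proof (weight_pos (S N + k)) as Hw; rewrite pow_add, <- Rmult_assoc in Hw.
  pose proof (b_bounds (S N + k)%nat).
  pose proof (profile_le_1 (b (S N + k)%nat * t) ltac:(nra)); nra. }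
lra.
Qed.

End Superposition.

(** The limit controls [g] only for large [t]; the bound on [[1, oo)] covers the remaining times,
    where a continuous majorant could not follow an unbounded [g]. The estimate on [h'] makes
    [sqrt (- h')] non-integrable at infinity. *)
Lemma smooth_convex_majorant (g : R -> R) :
  is_lim g p_infty 0 ->
  (exists M : R, forall t : R, 1 <= t -> g t <= M) ->
  exists (h h' : R -> R) (K c : R),
    0 < c /\
    (forall t, 0 < h t) /\
    (forall eps, 0 < eps -> exists t, h t < eps) /\
    (forall s t, 0 <= h s - h t - h' t * (s - t) <= K * (s - t) ^ 2) /\
    (forall t, h' t <= - c / (1 + t ^ 2)) /\
    (forall t, 1 <= t -> g t <= h t).
Proof.
intros g_lim [M0 HM0].
(* The maximum keeps [M] positive even if [M0] is not. *)
set (M := Rmax M0 1).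
assert (HM : 0 < M) by (unfold M; pose proof (Rmax_r M0 1); lra).
assert (HgM : forall t, 1 <= t -> g t <= M).
{ intros t Ht; apply Rle_trans with (1 := HM0 t Ht); apply Rmax_l. }
assert (Hex : forall n : nat, exists bn : R,
  0 < bn <= 1 /\ forall t, 1 < bn * t -> g t <= M * (/ 2) ^ S n).
{ intros n; apply is_lim_spec in g_lim.
  assert (Hp : 0 < M * (/ 2) ^ S n)
    by (apply Rmult_lt_0_compat; [lra | apply pow_lt; lra]).
  destruct (g_lim (mkposreal _ Hp)) as [T HT]; simpl in HT.
  pose proof (Rmax_l T 1) as H1; pose proof (Rmax_r T 1) as H2.
  exists (/ Rmax T 1); split; [split|].
  - apply Rinv_0_lt_compat; lra.
  - apply (Rmult_le_reg_l (Rmax T 1)); [lra|]; rewrite Rinv_r by lra; lra.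
  - intros t Ht.
    assert (Hlt : Rmax T 1 < t).
    { apply (Rmult_lt_compat_l (Rmax T 1)) in Ht; [|lra].
      rewrite <- Rmult_assoc, Rinv_r in Ht by lra; lra. }
    specialize (HT t ltac:(lra)); apply Rabs_lt_between in HT; simpl in HT |- *; lra. }
destruct (functional_choice _ Hex) as [b Hb].
assert (Hb1 : forall n, 0 < b n <= 1) by (intros n; apply Hb).
(* The factor [3] compensates the [/ 3] of [profile_ge]. *)
assert (HC : 0 < 3 * M) by lra.
exists (superposition (3 * M) b), (superposition' (3 * M) b), (2 * (3 * M)),
  (3 * M * b 0%nat / 2).
split; [pose proof (Hb1 0%nat); nra|].
split; [intros t; apply superposition_pos; assumption|].
split; [apply superposition_small; assumption|].
split; [apply superposition_quadratic; assumption|].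
split; [apply superposition'_le; assumption|].
intros t Ht; apply Rnot_lt_le; intros Hlt.
(* Either the [n]-th summand alone dominates [g t], or [t] lies beyond the
   [n]-th scale and the bound on [g t] improves. *)
assert (Hpow : forall n, g t <= M * (/ 2) ^ n).
{ induction n as [|n IHn]; [rewrite pow_O, Rmult_1_r; apply HgM; exact Ht|].
  apply Hb; apply Rnot_le_lt; intros Hle.
  pose proof (superposition_ge_term (3 * M) b HC Hb1 n t).
  pose proof (profile_ge _ Hle).
  assert (0 < (/ 2) ^ n) by (apply pow_lt; lra).
  assert (0 < M * (/ 2) ^ n) by nra; nra. }
(* Under [Hlt], [g t] exceeds a positive number, so it cannot stay below [M / 2 ^ n] for every
   [n]. *)
pose proof (superposition_pos (3 * M) b HC Hb1 t).
destruct (pow_lt_1_zero (/ 2) ltac:(rewrite Rabs_pos_eq; lra) (g t / M)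
  ltac:(apply Rdiv_lt_0_compat; lra)) as [N HN].
specialize (HN N (le_n N)); rewrite Rabs_pos_eq in HN by (left; apply pow_lt; lra).
apply (Rmult_lt_compat_l M) in HN; [|lra].
replace (M * (g t / M)) with (g t) in HN by (field; lra).
pose proof (Hpow N); lra.
Qed.

(** * The flow *)

Lemma is_derive_continuity_pt (f : R -> R) (x l : R) :
  is_derive f x l -> continuity_pt f x.
Proof.
intros H; apply continuity_pt_filterlim.
apply (ex_derive_continuous (K := R_AbsRing) (V := R_NormedModule)).
exists l; exact H.
Qed.

Lemma MVT_derive (F F' : R -> R) (a b : R) :
  (forall x, is_derive F x (F' x)) ->
  exists c, Rmin a b <= c <= Rmax a b /\ F b - F a = F' c * (b - a).
Proof.
intros H; apply MVT_gen; [intros x _; apply H|].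
intros x _; apply (is_derive_continuity_pt F x (F' x)), H.
Qed.

(** The values of [X] at [tau y - eps] and [tau y + eps] enclose [y], and a strictly increasing [X]
    reflects the order. *)
Lemma continuous_inverse (X tau : R -> R) (y : R) :
  (forall s t, s < t -> X s < X t) -> (forall z, X (tau z) = z) ->
  continuous tau y.
Proof.
intros incr inv; apply continuity_pt_filterlim; intros eps Heps.
set (t := tau y).
pose proof (incr (t - eps) t ltac:(lra)) as H1.
pose proof (incr t (t + eps) ltac:(lra)) as H2.
assert (Hy : X t = y) by apply inv; rewrite Hy in H1, H2.
exists (Rmin (y - X (t - eps)) (X (t + eps) - y)).
split; [apply Rmin_glb_lt; lra|].
intros z [_ Hz]; simpl in Hz |- *; unfold Rdist in *.
apply Rmin_Rgt in Hz; destruct Hz as [Hz1 Hz2].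
apply Rabs_lt_between in Hz1; apply Rabs_lt_between in Hz2.
assert (Hrefl : forall s r, X s < X r -> s < r).
{ intros s r Hsr; apply Rnot_le_lt; intros [H|H]; [apply incr in H; lra|].
  rewrite H in Hsr; lra. }
apply Rabs_lt_between.
pose proof (Hrefl (t - eps) (tau z)) as H3; pose proof (Hrefl (tau z) (t + eps)) as H4.
rewrite inv in H3, H4; fold t; split; [specialize (H3 ltac:(lra)); lra|].
specialize (H4 ltac:(lra)); lra.
Qed.

(** To the left of [0] the slope is at least [k], so [X] falls at least linearly; to the right
    [X t - k * ln (1 + t)] is nondecreasing, so [X] grows at least logarithmically. The abscissas
    [- (r / k)] and [exp (r / k) - 1] are where these bounds reach a change of [r]. *)
Lemma primitive_surjective (X v : R -> R) (k : R) :
  0 < k -> (forall t, is_derive X t (v t)) ->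
  (forall s t, s <= t -> v t <= v s) ->
  (forall t, 0 <= t -> k / (1 + t) <= v t) ->
  forall y, exists t, X t = y.
Proof.
intros Hk HX Hdec Hlow y.
assert (Hcont : continuity X)
  by (intros t; apply (is_derive_continuity_pt X t (v t)), HX).
assert (Hk0 : k <= v 0) by (pose proof (Hlow 0 ltac:(lra)); lra).
set (r := Rabs (y - X 0)).
assert (Hr : 0 <= r) by apply Rabs_pos.
assert (Hyr : - r <= y - X 0 <= r) by (apply Rabs_le_between; unfold r; lra).
assert (Hleft : X (- (r / k)) <= y).
{ assert (Hrk : 0 <= r / k)
    by (apply Rmult_le_pos; [exact Hr | left; apply Rinv_0_lt_compat; exact Hk]).
  destruct (MVT_derive X v (- (r / k)) 0 HX) as [c [Hc Hm]].
  rewrite Rmax_right in Hc by lra.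
  pose proof (Hdec c 0 ltac:(lra)).
  assert (Hkr : k * (r / k) = r) by (field; lra).
  assert (k * (r / k) <= v c * (r / k)) by (apply Rmult_le_compat_r; lra).
  lra. }
assert (Hright : y <= X (exp (r / k) - 1)).
{ assert (He : 1 <= exp (r / k)).
  { rewrite <- exp_0; destruct Hr as [Hr|Hr].
    - left; apply exp_increasing, Rdiv_lt_0_compat; assumption.
    - rewrite <- Hr; unfold Rdiv; rewrite Rmult_0_l; lra. }
  set (T := exp (r / k) - 1).
  assert (HD : forall t, 0 <= t ->
    is_derive (fun t => X t - k * ln (1 + t)) t (v t - k * / (1 + t))).
  { intros t Ht; apply (is_derive_minus X (fun t => k * ln (1 + t))); [apply HX|].
    auto_derive; [lra | field; lra]. }
  (* The logarithm restricts the derivative to part of the line, so the mean value theorem is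
     applied on [[0, T]] only. *)
  destruct (MVT_gen (fun t => X t - k * ln (1 + t)) 0 T
    (fun t => v t - k * / (1 + t))) as [c [Hc Hm]].
  - rewrite Rmin_left by (unfold T; lra); intros t Ht; apply HD; lra.
  - rewrite Rmin_left by (unfold T; lra); intros t Ht.
    apply (is_derive_continuity_pt _ t (v t - k * / (1 + t))), HD; lra.
  - rewrite Rmin_left in Hc by (unfold T; lra).
    pose proof (Hlow c ltac:(lra)) as Hv; unfold Rdiv in Hv.
    replace (1 + T) with (exp (r / k)) in Hm by (unfold T; ring).
    rewrite ln_exp, Rplus_0_r, ln_1 in Hm.
    assert (0 <= (v c - k * / (1 + c)) * (T - 0))
      by (apply Rmult_le_pos; unfold T; lra).
    assert (Hkr : k * (r / k) = r) by (field; lra).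
    lra. }
destruct (IVT_gen X (- (r / k)) (exp (r / k) - 1) y Hcont) as [t [_ Ht]].
- split; [apply Rle_trans with (2 := Hleft); apply Rmin_l|].
  apply Rle_trans with (1 := Hright); apply Rmax_r.
- exists t; exact Ht.
Qed.

(** The inverse [tau] is part of the conclusion because it shows that every value of [f] is a value
    of [h], hence positive once [h] is. *)
Lemma flow_of_energy (h h' : R -> R) (K c : R) :
  0 < c ->
  (forall s t, 0 <= h s - h t - h' t * (s - t) <= K * (s - t) ^ 2) ->
  (forall t, h' t <= - c / (1 + t ^ 2)) ->
  exists f x tau : R -> R,
    is_convex f /\ is_C1 f /\ is_gradient_flow f x /\
    (forall t, f (x t) = h t) /\ (forall y, f y = h (tau y)).
Proof.
intros Hc quad Hle.
assert (Hch : forall t, continuous h' t)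
  by (intros t; apply (smooth_convex_continuous h h' K); exact quad).
assert (Hdh : forall t, is_derive h t (h' t)).
{ intros t; apply subgradient_is_derive; [|apply Hch].
  intros s r; pose proof (quad r s); lra. }
assert (Hneg : forall t, h' t < 0).
{ intros t; apply Rle_lt_trans with (1 := Hle t).
  pose proof (pow2_ge_0 t).
  assert (0 < c / (1 + t ^ 2)) by (apply Rdiv_lt_0_compat; lra).
  unfold Rdiv in *; lra. }
set (v t := sqrt (- h' t)).
assert (Hvpos : forall t, 0 < v t) by (intros t; apply sqrt_lt_R0; pose proof (Hneg t); lra).
assert (Hvv : forall t, v t * v t = - h' t)
  by (intros t; apply sqrt_sqrt; pose proof (Hneg t); lra).
assert (Hvdec : forall s t, s <= t -> v t <= v s).
{ intros s t [Hst|Hst]; [|rewrite Hst; lra].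
  apply sqrt_le_1_alt; pose proof (quad s t); pose proof (quad t s); nra. }
assert (Hvc : forall t, continuous v t).
{ intros t; apply (continuous_comp (fun t => - h' t) sqrt); [|apply continuous_sqrt].
  apply (continuous_opp (V := R_NormedModule)); apply Hch. }
set (X t := RInt v 0 t).
assert (HX : forall t, is_derive X t (v t)).
{ intros t; apply (is_derive_RInt v X 0 t); [|apply Hvc].
  apply filter_forall; intros s; apply (RInt_correct v).
  apply (ex_RInt_continuous v); intros z _; apply Hvc. }
(* This uses [1 + t ^ 2 <= (1 + t) ^ 2] for [t >= 0]. *)
assert (Hvlow : forall t, 0 <= t -> sqrt c / (1 + t) <= v t).
{ intros t Ht; unfold v.
  rewrite <- (sqrt_square (1 + t)) at 1 by lra.
  rewrite <- sqrt_div_alt by nra.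
  apply sqrt_le_1_alt.
  apply Rle_trans with (c / (1 + t ^ 2)).
  - apply Rmult_le_compat_l; [lra|]; apply Rinv_le_contravar; nra.
  - pose proof (Hle t); unfold Rdiv in *; lra. }
assert (Hsurj : forall y, exists t, X t = y).
{ apply (primitive_surjective X v (sqrt c)); try assumption.
  apply sqrt_lt_R0; exact Hc. }
destruct (functional_choice _ Hsurj) as [tau Htau].
assert (Hincr : forall s t, s < t -> X s < X t).
{ intros s t Hst; destruct (MVT_derive X v s t HX) as [u [_ Hm]].
  pose proof (Hvpos u); nra. }
assert (HtauX : forall t, tau (X t) = t).
{ intros t; pose proof (Htau (X t)) as H.
  destruct (Rtotal_order (tau (X t)) t) as [Hlt|[Heq|Hgt]]; [|exact Heq|].
  - apply Hincr in Hlt; lra.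
  - apply Hincr in Hgt; lra. }
(* The derivative of [h + v t * X] at [u] is [v u * (v t - v u)], which has the
   sign of [u - t]. *)
assert (Hsub : forall t s, h t - v t * (X s - X t) <= h s).
{ intros t s.
  destruct (MVT_derive (fun u => h u + v t * X u)
    (fun u => h' u + v t * v u) t s) as [u [Hu Hm]].
  { intros u; apply (is_derive_plus h (fun u => v t * X u)); [apply Hdh|].
    apply (is_derive_scal X u (v t)); apply HX. }
  assert (H0 : 0 <= (h' u + v t * v u) * (s - t)).
  { replace (h' u + v t * v u) with (v u * (v t - v u))
      by (pose proof (Hvv u); lra).
    pose proof (Hvpos u).
    destruct (Rle_dec t s) as [Hts|Hts].
    - rewrite Rmin_left in Hu by lra; pose proof (Hvdec t u ltac:(lra)).
      apply Rmult_le_pos; [apply Rmult_le_pos|]; lra.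
    - rewrite Rmax_left in Hu by lra; pose proof (Hvdec u t ltac:(lra)).
      assert (0 <= v u * (v u - v t)) by (apply Rmult_le_pos; lra); nra. }
  lra. }
set (f y := h (tau y)); set (q y := - v (tau y)).
assert (Hfsub : forall y z, f y + q y * (z - y) <= f z).
{ intros y z; pose proof (Hsub (tau y) (tau z)) as H; rewrite !Htau in H.
  unfold f, q; lra. }
assert (Hqc : forall y, continuous q y).
{ intros y; apply (continuous_opp (V := R_NormedModule) (fun y => v (tau y))).
  apply (continuous_comp tau v); [|apply Hvc].
  apply (continuous_inverse X); assumption. }
assert (Hfd : forall y, is_derive f y (q y))
  by (intros y; apply subgradient_is_derive; [exact Hfsub | apply Hqc]).
exists f, X, tau.
split; [apply (subgradient_convex f q); exact Hfsub|].
split; [split|split; [|split]].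
- intros y; exists (q y); apply Hfd.
- intros y; apply (continuous_ext q); [|apply Hqc].
  intros z; symmetry; apply is_derive_unique, Hfd.
(* At [X t] the slope of [f] is [- v (tau (X t)) = - v t]; the two-sided derivative of [X] then
   restricts to [[0, oo)]. *)
- intros t _; unfold D_in.
  rewrite (is_derive_unique _ _ _ (Hfd (X t))); unfold q; rewrite HtauX, Ropp_involutive.
  apply (limit1_imp _ (D_x no_cond t)); [intros s [_ Hs]; split; [exact I | exact Hs]|].
  apply (derivable_pt_lim_D_in X v t), is_derive_Reals, HX.
- intros t; unfold f; rewrite HtauX; reflexivity.
- reflexivity.
Qed.

Theorem lemma2p11 (g : R -> R)
  (g_lim : is_lim g p_infty 0)
  (g_bdd : exists M : R, forall t : R, 1 <= t -> g t <= M) :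
  exists f x : R -> R,
    is_convex f /\ is_C1 f /\ is_gradient_flow f x /\
    is_glb_Rbar (fun y => exists z : R, y = f z) 0 /\
    (forall t : R, 1 <= t -> f (x t) >= g t).
Proof.
destruct (smooth_convex_majorant g g_lim g_bdd)
  as [h [h' [K [c [Hc [Hpos [Hsmall [quad [Hle Hg]]]]]]]]].
destruct (flow_of_energy h h' K c Hc quad Hle)
  as [f [x [tau [Hconv [HC1 [Hflow [Hfx Hftau]]]]]]].
exists f, x; split; [exact Hconv|]; split; [exact HC1|]; split; [exact Hflow|].
split; [split|].
- intros y [z ->]; simpl; rewrite Hftau; left; apply Hpos.
(* A positive real [l] is undercut by a small value of [h], which [f] takes on the curve; [p_infty]
   is refuted by the value [f 0]. *)
- intros l Hl; destruct l as [l| |]; simpl; [| |exact I].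
  + apply Rnot_lt_le; intros Hl0; destruct (Hsmall l Hl0) as [t Ht].
    pose proof (Hl (f (x t)) (ex_intro _ (x t) eq_refl)) as H; simpl in H.
    rewrite Hfx in H; lra.
  + exact (Hl (f 0) (ex_intro _ 0 eq_refl)).
- intros t Ht; rewrite Hfx; apply Rle_ge, Hg; exact Ht.
Qed.
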